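(* There is an absolute constant $C$ such that the following holds. Let $R>0$, $0<d\le R/2$, $\nu>0$, $c>0$, let $k\ne0$ be a tangential Fourier frequency, and let $F=\Gamma/r^2$ on the collar $C_{R,d}$. Assume that $|\Gamma|\le\Gamma_*$ on the collar, that the tangential-time face area of the collar is at most $A_\Sigma$, and that $d\le c/|k|$. Then the native trace energy satisfies $$\mathcal E_k\le C\,\frac{c^2A_\Sigma\Gamma_*^4}{\nu|k|R^5}.$$ Consequently any trace-energy floor $\mathcal E_k\ge e_*>0$ forces $$|k|R^5\le C\,\frac{c^2A_\Sigma\Gamma_*^4}{\nu e_*}.$$ Thus, for families of such collars with $c,A_\Sigma,\Gamma_*,\nu$ fixed: if $R\ge R_0>0$ uniformly and $|k|\to\infty$, then $\mathcal E_k\to0$; and if $\mathcal E_k\ge e_*>0$ persists while $|k|\to\infty$, then $$R\lesssim|k|^{-1/5},$$ with an implied constant depending only on $c,A_\Sigma,\Gamma_*,\nu,e_*$.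
   Context: Cylindrical coordinates $(r,z)$ and time $t$; $u^\theta$ is the azimuthal velocity, $F=u^\theta/r$, $\Gamma=ru^\theta$, so $F=\Gamma/r^2$. For $0<d\le R/2$ the collar is $C_{R,d}=\{R-d\le r\le R+d\}$, with $z$ ranging over a tangential domain $J$ and $t$ over a time interval $I$. The tangential-time face area is the measure of $J\times I$ in the variables $(z,t)$. Define $$\mu(z,t)=\int_{R-d}^{R+d}F(r,z,t)^2\,dr\ge0,$$ and let $\mu_k(t)$ be its tangential ($z$) Fourier coefficient at frequency $k$, with the $L^2$-normalized convention in which $|\mu_k(t)|\le\|\mu(\cdot,t)\|_{L^2_z}$. The native sheet is $\sigma_k=ik\mu_k$; it is related to a trace $f_k$ by the decaying two-sided transmission law at zero temporal frequency $\sigma_k=2\nu|k|f_k$, so that $f_k=\frac{i\,\mathrm{sgn}\,k}{2\nu}\mu_k$. The (weighted) native trace energy is $$\mathcal E_k=2\nu R^3|k|\int_I|f_k|^2\,dt=\frac{R^3|k|}{2\nu}\int_I|\mu_k|^2\,dt .$$ *)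

(* Defs.v *)
From HB Require Import structures.
From mathcomp Require Import all_boot all_order all_algebra.
From mathcomp Require Import complex.
From mathcomp Require Import all_classical all_reals all_analysis.

Set Implicit Arguments.
Unset Strict Implicit.
Unset Printing Implicit Defensive.

Import Order.TTheory GRing.Theory Num.Theory.
Import numFieldNormedType.Exports.

Local Open Scope classical_set_scope.
Local Open Scope ring_scope.
Local Open Scope complex_scope.

Section fourier.
Variable R : realType.
Let leb : set R -> \bar R := @lebesgue_measure R.

Definition Cintegral (D : set R) (g : R -> R[i]) : R[i] :=
  (\int[lebesgue_measure]_(x in D) complex.Re (g x))%R
  +i* (\int[lebesgue_measure]_(x in D) complex.Im (g x))%R.

Definition cis (x : R) : R[i] := cos x +i* sin x.

(* The pairing of g with the unit vector |J|^(-1/2) e^{ikz} of L^2(J, dz);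
   this normalization is the one for which |g_k| <= ||g||_{L^2(J, dz)}.
   When J is a period cell, the Fourier frequencies are the k with
   k |J| an integer multiple of 2 pi; here k may be any real number. *)
Definition fourier_coef (J : set R) (k : R) (g : R -> R) : R[i] :=
  ((Num.sqrt (fine (leb J)))^-1)%:C
  * Cintegral J (fun z => (g z)%:C * cis (- (k * z))).

End fourier.

(* A swirl field on a collar: the geometry, the tangential frequency, and the
   azimuthal velocity as a function of r, z and t in this order. *)
Record collar (R : realType) := Collar {
  collar_radius : R;
  halfwidth : R;
  freq : R;
  zdomain : set R;
  times : set R;
  utheta : R -> R -> R -> R }.

Section collar_theory.
Variable R : realType.
Implicit Types (X : collar R) (nu c A Gs : R).
Let leb : set R -> \bar R := @lebesgue_measure R.

Definition collar_range X : set R :=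
  `[collar_radius X - halfwidth X, collar_radius X + halfwidth X]%classic.

Definition swirl_F X (r z t : R) : R := utheta X r z t / r.
Definition swirl_Gamma X (r z t : R) : R := r * utheta X r z t.

Definition mu_density X (z t : R) : R :=
  (\int[lebesgue_measure]_(r in collar_range X) (swirl_F X r z t ^+ 2))%R.

Definition mu_hat X (t : R) : R[i] :=
  fourier_coef (zdomain X) (freq X) (fun z => mu_density X z t).

Definition native_sheet X (t : R) : R[i] := 'i * (freq X)%:C * mu_hat X t.

(* The solution f of the transmission law sigma = 2 nu |k| f,
   see native_trace_law. *)
Definition native_trace nu X (t : R) : R[i] :=
  native_sheet X t / (2 * nu * `|freq X|)%:C.

(* Extended-real valued, so that a divergent integral would count as +oo. *)
Definition trace_energy nu X : \bar R :=
  ((2 * nu * collar_radius X ^+ 3 * `|freq X|)%:E *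
   \int[lebesgue_measure]_(t in times X)
     ((Normc.normc (native_trace nu X t)) ^+ 2)%:E)%E.

Definition face_area X : \bar R :=
  (lebesgue_measure \x lebesgue_measure)%E (zdomain X `*` times X).

Definition admissible X : Prop :=
  [/\ 0 < collar_radius X,
      0 < halfwidth X <= collar_radius X / 2,
      freq X != 0,
      [/\ measurable (zdomain X), (0 < leb (zdomain X) < +oo)%E
        & is_interval (times X)]
    & measurable_fun (collar_range X `*` (zdomain X `*` times X))
        (fun p : R * (R * R) => utheta X p.1 p.2.1 p.2.2)].

Definition collar_bounds c A Gs X : Prop :=
  [/\ forall r z t, collar_range X r -> zdomain X z -> times X t ->
        `|swirl_Gamma X r z t| <= Gs,
      (face_area X <= A%:E)%E
    & halfwidth X <= c / `|freq X|].

Lemma swirl_F_Gamma X r z t :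
  r != 0 -> swirl_F X r z t = swirl_Gamma X r z t / r ^+ 2.
Proof.
move=> r0; rewrite /swirl_F /swirl_Gamma expr2 invfM mulrACA mulfV// mul1r.
by [].
Qed.

Lemma native_trace_law nu X t : nu != 0 -> freq X != 0 ->
  native_sheet X t = (2 * nu * `|freq X|)%:C * native_trace nu X t.
Proof.
move=> nu0 k0; rewrite /native_trace mulrC divfK//.
by rewrite fmorph_eq0 !mulf_neq0// ?normr_eq0// pnatr_eq0.
Qed.

Lemma native_traceE nu X t : nu != 0 -> freq X != 0 ->
  native_trace nu X t = 'i * (Num.sg (freq X) / (2 * nu))%:C * mu_hat X t.
Proof.
move=> nu0 k0; rewrite /native_trace /native_sheet.
have nk0 : `|freq X| != 0 by rewrite normr_eq0.
rewrite -fmorphV mulrAC -(mulrA 'i) -rmorphM /=; congr (_ * _%:C * _).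
by rewrite {1}[freq X]numEsg invfM mulrACA mulfV// mulr1.
Qed.

End collar_theory.

(* Main.v *)
(* On the collar r >= R/2, so F^2 = Gamma^2 / r^4 <= 16 Gamma_*^2 / R^4 and mu,
   an integral over an interval of length 2d, is at most 32 d Gamma_*^2 / R^4.
   With the L^2-normalized coefficient this bounds |mu_k|^2 by the square of
   that sup times 2|J|, and integrating in t produces |J| |I| <= A_Sigma.
   Inserting d <= c/|k| into E_k = R^3 |k| / (2 nu) * int |mu_k|^2 turns
   |k| d^2 into c^2/|k|; the remaining claims are algebra on this bound. *)
Require Import Defs.
From HB Require Import structures.
From mathcomp Require Import all_boot all_order all_algebra.
From mathcomp Require Import complex.
From mathcomp Require Import all_classical all_reals all_analysis.
From mathcomp Require Import ring lra.
Set Implicit Arguments.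
Unset Strict Implicit.
Unset Printing Implicit Defensive.

Import Order.TTheory GRing.Theory Num.Theory.
Import numFieldNormedType.Exports.
Local Open Scope classical_set_scope.
Local Open Scope ring_scope.

(** * Integral bounds valid for arbitrary, possibly non-measurable, integrands *)

Section integral_bounds.
Context d (T : measurableType d) (R : realType).
Variable mu : {measure set T -> \bar R}.
Implicit Types (D : set T) (f : T -> R) (M : R).

(* The integral of a nonnegative function is a supremum over the simple
   functions below it, so monotonicity needs no measurability. *)
Lemma nonmeas_ge0_le_integral D (f g : T -> \bar R) :
  (forall x, D x -> (0 <= f x)%E) -> (forall x, D x -> (f x <= g x)%E) ->
  (\int[mu]_(x in D) f x <= \int[mu]_(x in D) g x)%E.
Proof.
move=> f0 fg.
have g0 x : D x -> (0 <= g x)%E.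
  by move=> Dx; exact: le_trans (f0 x Dx) (fg x Dx).
rewrite !ge0_integralE//; apply: le_ereal_sup => _ [h hf <-].
exists h => // x; apply: le_trans (hf x) _.
by rewrite /patch; case: ifPn => //; rewrite inE => /fg.
Qed.

Lemma nonmeas_ge0_integral_le_cst D (f : T -> \bar R) M : measurable D ->
  (forall x, D x -> (0 <= f x <= M%:E)%E) ->
  (\int[mu]_(x in D) f x <= M%:E * mu D)%E.
Proof.
move=> mD fM; rewrite -integral_cst//.
by apply: nonmeas_ge0_le_integral => x /fM /andP[].
Qed.

(** The positive and negative parts of [f] each have integral in [[0, M * mu D]], and two numbers of
    that interval differ by at most its length. Splitting into parts therefore costs no factor 2. *)
Lemma nonmeas_normr_Rintegral_le D f M : measurable D ->
  (mu D < +oo)%E -> 0 <= M -> (forall x, D x -> `|f x| <= M) ->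
  `|\int[mu]_(x in D) f x| <= M * fine (mu D).
Proof.
move=> mD Dfin M0 fM.
have Dnum : mu D \is a fin_num by rewrite ge0_fin_numE.
(* Each part is exhibited as a genuine real [r], so that the [fine] hidden in [Rintegral] returns
   the actual value and not its default at an infinity. *)
have part_le (h : T -> \bar R) :
    (forall x, D x -> (0 <= h x <= M%:E)%E) ->
    exists2 r, (\int[mu]_(x in D) h x)%E = r%:E & 0 <= r <= M * fine (mu D).
  move=> hM.
  have h0 : (0 <= \int[mu]_(x in D) h x)%E.
    by apply: integral_ge0 => x /hM /andP[].
  have := nonmeas_ge0_integral_le_cst mD hM.
  rewrite -(fineK Dnum) -EFinM => hle; move: h0 hle.
  case: (integral mu D h) => [r| |]//; rewrite !lee_fin => r0 rM.
  by exists r => //; rewrite r0.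
rewrite /Rintegral integralE.
have [x Dx|p -> /andP[p0 pM]] := part_le (fun x => (EFin \o f)^\+ x)%E.
  rewrite funeposE /= le_max lexx orbT /= -EFin_max lee_fin ge_max M0 andbT.
  exact: le_trans (ler_norm _) (fM _ Dx).
have [x Dx|q -> /andP[q0 qM]] := part_le (fun x => (EFin \o f)^\- x)%E.
  rewrite funenegE /= le_max lexx orbT /= -EFin_max lee_fin ge_max M0 andbT.
  by rewrite (le_trans (ler_norm _))// normrN fM.
by rewrite -EFinB /= ler_norml; lra.
Qed.

End integral_bounds.

(** * From the collar geometry to a pointwise bound on the native trace *)

Section collar_energy.
Variable R : realType.
Implicit Types (X : collar R) (nu c A Gs : R).
Let leb : set R -> \bar R := @lebesgue_measure R.

Lemma normc_sqr (x y : R) : Normc.normc (Complex x y) ^+ 2 = x ^+ 2 + y ^+ 2.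
Proof. by rewrite /= sqr_sqrtr// addr_ge0// sqr_ge0. Qed.

(* The factor 2 comes from bounding the real and imaginary parts separately. *)
Lemma fourier_coef_le (J : set R) (k : R) (g : R -> R) (M : R) :
  measurable J -> (0 < leb J < +oo)%E -> 0 <= M ->
  (forall z, J z -> `|g z| <= M) ->
  Normc.normc (fourier_coef J k g) ^+ 2 <= 2 * M ^+ 2 * fine (leb J).
Proof.
move=> mJ /andP[J0 Joo] M0 gM.
have j0 : 0 < fine (leb J) by rewrite fine_gt0// J0.
rewrite /fourier_coef Normc.normcM exprMn.
have bnd (h : R -> R) : (forall z, `|h z| <= 1) ->
    (\int[leb]_(z in J) (g z * h z))^+2 <= (M * fine (leb J)) ^+ 2.
  move=> h1; rewrite -real_normK ?num_real//.
  rewrite ler_sqr ?nnegrE ?mulr_ge0 ?(ltW j0)//.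
  apply: nonmeas_normr_Rintegral_le => // z Jz.
  by rewrite normrM -[leRHS]mulr1 ler_pM// gM.
rewrite [X in _ * X]normc_sqr.
(* The squared normalization [1/|J|] cancels one of the two factors [|J|] in [(M |J|)^2], leaving a
   bound linear in [|J|]. *)
have -> : Normc.normc (((Num.sqrt (fine (leb J)))^-1)%:C)%C ^+ 2 =
    (fine (leb J))^-1.
  by rewrite normc_sqr expr0n addr0 exprVn sqr_sqrtr// ltW.
rewrite mulrC ler_pdivrMr// /Cintegral.
have reE : (fun z => complex.Re ((g z)%:C%C * cis (- (k * z)))) =
    (fun z => g z * cos (- (k * z))).
  by apply/funext => z /=; rewrite mul0r subr0.
have imE : (fun z => complex.Im ((g z)%:C%C * cis (- (k * z)))) =
    (fun z => g z * sin (- (k * z))).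
  by apply/funext => z /=; rewrite mul0r addr0.
rewrite reE imE.
have hc := bnd (fun z => cos (- (k * z))) (fun z => cos_max _).
have hs := bnd (fun z => sin (- (k * z))) (fun z => sin_max _).
apply: le_trans (lerD hc hs) _.
by rewrite exprMn -mulr2n -[leLHS]mulr_natl [fine _ ^+ 2]expr2 !mulrA.
Qed.

Lemma mu_density_le X Gs (z t : R) :
  0 < collar_radius X -> 0 < halfwidth X <= collar_radius X / 2 ->
  (forall r, collar_range X r -> `|swirl_Gamma X r z t| <= Gs) ->
  `|mu_density X z t| <= 32 * halfwidth X * Gs ^+ 2 / collar_radius X ^+ 4.
Proof.
set b := collar_radius X; set d := halfwidth X => b0 /andP[d0 db] hG.
have len : lebesgue_measure (collar_range X) = (2 * d)%:E.
  rewrite lebesgue_measure_itv/= lte_fin -/b -/d ifT; last lra.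
  by rewrite -EFinB; congr EFin; lra.
have -> : 32 * d * Gs ^+ 2 / b ^+ 4 =
    16 * Gs ^+ 2 / b ^+ 4 * fine (leb (collar_range X)).
  by rewrite /leb len /=; field; lra.
have b40 : 0 < b ^+ 4 by rewrite exprn_gt0.
apply: nonmeas_normr_Rintegral_le => [|||r hr].
- exact: measurable_itv.
- by rewrite [ltLHS]len ltry.
- by rewrite divr_ge0 ?(ltW b40)// mulr_ge0// sqr_ge0.
have rb : b / 2 <= r.
  by move: hr; rewrite /collar_range /= in_itv /= -/b -/d; lra.
have r0 : 0 < r by lra.
rewrite ger0_norm ?sqr_ge0// swirl_F_Gamma ?gt_eqF// expr_div_n -exprM.
have G2 : swirl_Gamma X r z t ^+ 2 <= Gs ^+ 2.
  have := hG r hr; rewrite ler_norml; nra.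
have -> : 16 * Gs ^+ 2 / b ^+ 4 = Gs ^+ 2 / (b / 2) ^+ 4 by field; lra.
apply: ler_pM => //; rewrite ?sqr_ge0 ?invr_ge0 ?exprn_ge0 ?(ltW r0)//.
by rewrite lef_pV2 ?posrE ?exprn_gt0 ?divr_gt0// lerXn2r ?nnegrE; lra.
Qed.

(** The multiplier [i sgn(k) / (2 nu)] has modulus [1 / (2 nu)]: the transmission law cancels the
    [|k|] of the sheet. *)
Lemma normc_native_trace_sqr X nu (t : R) : 0 < nu -> freq X != 0 ->
  Normc.normc (native_trace nu X t) ^+ 2 =
  Normc.normc (mu_hat X t) ^+ 2 / (2 * nu) ^+ 2.
Proof.
move=> nu0 k0; rewrite native_traceE ?(gt_eqF nu0)// mulrC.
apply: etrans (congr1 (fun x => x ^+ 2) (Normc.normcM _ _)) _.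
rewrite exprMn; congr (_ * _).
apply: etrans (congr1 (fun x => x ^+ 2) (Normc.normcM _ _)) _.
rewrite exprMn -complexiE !normc_sqr.
by rewrite !expr0n add0r addr0 expr1n mul1r expr_div_n sqr_sg k0 mul1r.
Qed.

(** The constant is [2 * 32^2 / 4]: the 2 from the Fourier coefficient, 32 from the density bound, 4
    from [(2 nu)^2]. The bound is uniform in [t], ready for integration in time. *)
Lemma native_trace_sqr_le X nu Gs (t : R) : 0 < nu -> admissible X ->
  (forall r z, collar_range X r -> zdomain X z ->
    `|swirl_Gamma X r z t| <= Gs) ->
  Normc.normc (native_trace nu X t) ^+ 2 <=
    512 * (halfwidth X ^+ 2 * Gs ^+ 4 / (nu ^+ 2 * collar_radius X ^+ 8))
      * fine (leb (zdomain X)).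
Proof.
move=> nu0 [b0 hd k0 [mJ hJ _] _] hG.
rewrite normc_native_trace_sqr//.
have M0 : 0 <= 32 * halfwidth X * Gs ^+ 2 / collar_radius X ^+ 4.
  move: hd => /andP[d0 _]; rewrite divr_ge0 ?exprn_ge0 ?(ltW b0)//.
  by rewrite mulr_ge0 ?sqr_ge0// mulr_ge0// ltW.
have /= := fourier_coef_le (freq X) mJ hJ M0
  (fun z Jz => mu_density_le b0 hd (fun r hr => hG r z hr Jz)).
rewrite -/(mu_hat X t) => h.
rewrite ler_pdivrMr ?exprn_gt0 ?mulr_gt0//.
apply: le_trans h _; rewrite le_eqVlt; apply/orP; left; apply/eqP.
by field; rewrite !gt_eqF.
Qed.

(** * The energy estimate and its floor form *)

Lemma trace_energy_ge0 X nu : 0 < nu -> 0 < collar_radius X ->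
  (0 <= trace_energy nu X)%E.
Proof.
move=> nu0 b0; apply: mule_ge0.
  by rewrite lee_fin !mulr_ge0 ?exprn_ge0 ?(ltW nu0) ?(ltW b0).
by apply: integral_ge0 => t _; rewrite lee_fin sqr_ge0.
Qed.

Lemma face_area_ge0 X A : (face_area X <= A%:E)%E -> 0 <= A.
Proof. by rewrite -lee_fin; apply: le_trans; exact: measure_ge0. Qed.

Lemma trace_energy_le X nu c A Gs : 0 < nu -> 0 < c ->
  admissible X -> collar_bounds c A Gs X ->
  (trace_energy nu X <=
    (1024 * (c ^+ 2 * A * Gs ^+ 4
            / (nu * `|freq X| * collar_radius X ^+ 5)))%:E)%E.
Proof.
move=> nu0 c0 aX [hG hA hd].
have A0 := face_area_ge0 hA.
have [b0 /andP[d0 _] k0 [mJ /andP[J0 Joo] itvI] _] := aX.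
have mI : measurable (times X).
  exact: measurable_realfun.is_interval_measurable.
have nk0 : 0 < `|freq X| by rewrite normr_gt0.
have Jnum : leb (zdomain X) \is a fin_num by rewrite ge0_fin_numE.
move: hA; rewrite /face_area product_measure1E// => hA.
have G4 : 0 <= Gs ^+ 4 by rewrite (exprM Gs 2 2) sqr_ge0.
set K := 512 * (halfwidth X ^+ 2 * Gs ^+ 4 / (nu ^+ 2 * collar_radius X ^+ 8)).
have K0 : 0 <= K.
  rewrite /K mulr_ge0 ?ler0n//; apply: divr_ge0.
    by rewrite mulr_ge0// sqr_ge0.
  by rewrite ltW// mulr_gt0// exprn_gt0.
have int_le : (\int[lebesgue_measure]_(t in times X)
    ((Normc.normc (native_trace nu X t)) ^+ 2)%:E <= (K * A)%:E)%E.
  (* The duration stays an extended real: only its product with [|J|], the face area, is compared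
     with [A]. *)
  apply: (@le_trans _ _ ((K * fine (leb (zdomain X)))%:E * leb (times X))%E).
    apply: nonmeas_ge0_integral_le_cst => // t It.
    rewrite !lee_fin sqr_ge0/=.
    by apply: native_trace_sqr_le => // r z hr hz; exact: hG.
  by rewrite !EFinM fineK// -muleA; apply: lee_wpmul2l; rewrite ?lee_fin.
apply: (@le_trans _ _
  ((2 * nu * collar_radius X ^+ 3 * `|freq X|)%:E * (K * A)%:E)%E).
  apply: lee_wpmul2l => //.
  by rewrite lee_fin !mulr_ge0 ?exprn_ge0 ?(ltW nu0) ?(ltW b0).
rewrite -EFinM lee_fin /K.
move: hd; rewrite ler_pdivlMr// => hd.
have hd2 : (halfwidth X * `|freq X|) ^+ 2 <= c ^+ 2.
  by rewrite lerXn2r ?nnegrE ?mulr_ge0 ?(ltW c0) ?(ltW d0).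
(* [W] is chosen so that [(d |k|)^2 * W] equals the energy prefactor times [K * A], while [c^2 * W]
   is the target. Here 1024 is [2 * 512], and the radius exponent is [8 - 3]. *)
pose W := 1024 * A * Gs ^+ 4 / (nu * `|freq X| * collar_radius X ^+ 5).
have W0 : 0 <= W.
  apply: divr_ge0; first exact: mulr_ge0 (mulr_ge0 (ler0n R 1024) A0) G4.
  by rewrite ltW// !mulr_gt0// exprn_gt0.
have := ler_wpM2r W0 hd2.
by congr (_ <= _); rewrite /W; field; rewrite !gt_eqF.
Qed.

Lemma trace_energy_floor X nu c A Gs e : 0 < nu -> 0 < c ->
  admissible X -> collar_bounds c A Gs X ->
  0 < e -> (e%:E <= trace_energy nu X)%E ->
  `|freq X| * collar_radius X ^+ 5 <= 1024 * (c ^+ 2 * A * Gs ^+ 4 / (nu * e)).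
Proof.
move=> nu0 c0 aX bX e0 /le_trans /(_ (trace_energy_le nu0 c0 aX bX)).
have [b0 _ k0 _ _] := aX.
have nk0 : 0 < `|freq X| by rewrite normr_gt0.
rewrite lee_fin !mulrA ler_pdivlMr ?mulr_gt0 ?exprn_gt0// => h.
rewrite ler_pdivlMr ?mulr_gt0//; apply: le_trans h.
by rewrite le_eqVlt; apply/orP; left; apply/eqP; ring.
Qed.

(** * Families of collars whose frequency diverges *)

Lemma trace_energy_cvg0 nu c A Gs (T : Type) (G : set_system T)
    (X : T -> collar R) (R0 : R) : ProperFilter G -> 0 < nu -> 0 < c ->
  (forall i, admissible (X i) /\ collar_bounds c A Gs (X i)) ->
  0 < R0 -> (forall i, R0 <= collar_radius (X i)) ->
  `|freq (X i)| @[i --> G] --> +oo ->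
  trace_energy nu (X i) @[i --> G] --> 0%E.
Proof.
move=> PG nu0 c0 hX R00 hR koo.
(* Replacing each radius by its lower bound [R0] makes the energy bound [B / |k|] with [B]
   independent of [i], so the energies are squeezed to 0. *)
pose B := 1024 * (c ^+ 2 * A * Gs ^+ 4 / (nu * R0 ^+ 5)).
apply: (@squeeze_cvge _ _ _ _ (cst 0%E) _ (fun i => (B * `|freq (X i)|^-1)%:E)).
- apply: nearW => i; have [aX bX] := hX i.
  have [b0 _ k0 _ _] := aX.
  have [_ /face_area_ge0 A0 _] := bX.
  rewrite trace_energy_ge0//=.
  apply: le_trans (trace_energy_le nu0 c0 aX bX) _.
  rewrite lee_fin /B -[leRHS]mulrA; apply: ler_wpM2l; first exact: ler0n.
  have G4 : 0 <= Gs ^+ 4 by rewrite (exprM Gs 2 2) sqr_ge0.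
  rewrite -[leRHS]mulrA; apply: ler_wpM2l.
    exact: mulr_ge0 (mulr_ge0 (sqr_ge0 c) A0) G4.
  rewrite -!invfM lef_pV2 ?posrE ?mulr_gt0 ?exprn_gt0 ?normr_gt0//.
  rewrite [leLHS]mulrAC ler_wpM2l ?mulr_ge0 ?(ltW nu0)//.
  by rewrite lerXn2r ?nnegrE ?(ltW R00) ?(ltW b0).
- exact: cvg_cst.
- apply: cvg_EFin; first exact: nearW.
  rewrite -(mulr0 B); apply: cvgMr.
  apply/gtr0_cvgV0 => //; apply: nearW => i.
  by have [[_ _ k0 _ _] _] := hX i; rewrite normr_gt0.
Qed.

(** Taking [n]-th roots is monotone on nonnegative reals, and the real power splits over the product
    [y * x ^+ n]. With [n = 5] this turns the floor inequality into the decay rate of the radius. *)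
Lemma le_root_of_mulX_le (n : nat) (x y K : R) : (0 < n)%N ->
  0 <= x -> 0 < y -> y * x ^+ n <= K ->
  x <= K `^ (n%:R)^-1 * y `^ (- (n%:R)^-1).
Proof.
move=> n0 x0 y0 h.
have xE : x = (x ^+ n) `^ (n%:R)^-1.
  by rewrite -powR_mulrn// -powRrM mulfV ?pnatr_eq0 -?lt0n// powRr1.
have K0 : 0 <= K by apply: le_trans h; rewrite mulr_ge0 ?exprn_ge0 ?(ltW y0).
rewrite powRN ler_pdivlMr ?powR_gt0// {1}xE -powRM ?exprn_ge0 ?(ltW y0)//.
apply: ge0_ler_powR; rewrite ?nnegrE ?invr_ge0 ?ler0n ?mulr_ge0//.
- by rewrite exprn_ge0.
- exact: ltW.
- by rewrite mulrC.
Qed.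

End collar_energy.

Theorem theorem4p2 (R : realType) :
  (exists C : R, 0 < C /\
    forall (X : collar R) (nu c A Gs : R), 0 < nu -> 0 < c ->
      admissible X -> collar_bounds c A Gs X ->
      (trace_energy nu X <=
        (C * (c ^+ 2 * A * Gs ^+ 4
              / (nu * `|freq X| * collar_radius X ^+ 5)))%:E)%E /\
      (forall e : R, 0 < e -> (e%:E <= trace_energy nu X)%E ->
        `|freq X| * collar_radius X ^+ 5 <=
          C * (c ^+ 2 * A * Gs ^+ 4 / (nu * e)))) /\
  (forall nu c A Gs : R, 0 < nu -> 0 < c ->
    (forall (T : Type) (G : set_system T) (X : T -> collar R) (R0 : R),
      ProperFilter G ->
      (forall i, admissible (X i) /\ collar_bounds c A Gs (X i)) ->
      0 < R0 -> (forall i, R0 <= collar_radius (X i)) ->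
      `|freq (X i)| @[i --> G] --> +oo ->
      trace_energy nu (X i) @[i --> G] --> 0%E) /\
    (forall e : R, 0 < e ->
      exists C' : R, 0 < C' /\
      forall (T : Type) (G : set_system T) (X : T -> collar R),
      ProperFilter G ->
      (forall i, admissible (X i) /\ collar_bounds c A Gs (X i)) ->
      (forall i, (e%:E <= trace_energy nu (X i))%E) ->
      `|freq (X i)| @[i --> G] --> +oo ->
      forall i, collar_radius (X i) <= C' * `|freq (X i)| `^ (- (5%:R)^-1))).
Proof.
split.
  exists 1024; split=> [|X nu c A Gs nu0 c0 aX bX]; first exact: ltr0Sn.
  split.
    exact: trace_energy_le.
  by move=> e e0; exact: trace_energy_floor.
move=> nu c A Gs nu0 c0; split.
  move=> T G X R0 PG hX R00 hR koo.
  exact: (trace_energy_cvg0 PG nu0 c0 hX R00 hR koo).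
move=> e e0; pose K := 1024 * (c ^+ 2 * A * Gs ^+ 4 / (nu * e)).
(* The witness is fixed before any collar is given, so the sign of [A], hence of [K], is unknown
   here; [|K| + 1] is positive in all cases and dominates [K]. *)
exists ((`|K| + 1) `^ 5^-1); split; first by rewrite powR_gt0// ltr_pwDr.
move=> T G X PG hX he koo i; have [aX bX] := hX i.
have [b0 _ k0 _ _] := aX.
apply: le_root_of_mulX_le; rewrite ?normr_gt0 ?(ltW b0)//.
apply: le_trans (trace_energy_floor nu0 c0 aX bX e0 (he i)) _.
by rewrite -/K (le_trans (ler_norm _))// lerDl.
Qed.
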